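(* Let $(\Gamma,P)$, with $\Gamma=(N,K,C,T)$ and $P=\{P_1,\dots,P_A\}$, be a generalized highway problem with a coalitional structure, and let $(N,c,P)$ be its associated game with a coalitional structure. For $t\in K$ let $\mathscr{A}_t=\{a\in\{1,\dots,A\}\mid t\in T(P_a)\}$ and $N_t^a=\{i\in P_a\mid t\in T(i)\}$. Then the Owen value $\Psi$ of $(N,c,P)$ is given by $$\Psi_i(N,c,P)=\sum_{t\in T(i)}\frac{C(t)}{|\mathscr{A}_t|\cdot|N_t^a|}$$ for every $a\in\{1,\dots,A\}$ and every $i\in P_a$.
   Context: A generalized highway problem is a 4-tuple $\Gamma=(N,K,C,T)$ where $N$ is a finite set of agents, $K$ is a finite nonempty ordered set of sections, $C:K\to\mathbb{R}_+$ gives the cost $C(t)$ of each section, and $T:N\to 2^K\setminus\{\emptyset\}$ gives the set $T(i)$ of sections used by agent $i$, with $\bigcup_{i\in N}T(i)=K$. For $S\subseteq N$ put $T(S)=\bigcup_{i\in S}T(i)$, and for $K'\subseteq K$ put $C(K')=\sum_{t\in K'}C(t)$. The associated cost game is $(N,c)$ with $c(S)=C(T(S))$ for $S\subseteq N$. If $P=\{P_1,\dots,P_A\}$ is a partition of $N$ (into nonempty a priori unions), the pair $(\Gamma,P)$ is a generalized highway problem with a coalitional structure and $(N,c,P)$ is its associated game with a coalitional structure. Write $M=\{1,\dots,A\}$. For a cost game $(N,c,P)$ with a coalitional structure (with $c:2^N\to\mathbb{R}$, $c(\emptyset)=0$), the Owen value is, for $i\in P_a$, $$\Psi_i(N,c,P)=\sum_{H\subseteq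 M\setminus\{a\}}\ \sum_{S\subseteq P_a\setminus\{i\}}\frac{1}{|P_a|\cdot A}\cdot\frac{1}{\binom{A-1}{|H|}\binom{|P_a|-1}{|S|}}\bigl(c(R\cup S\cup\{i\})-c(R\cup S)\bigr),\qquad R=\bigcup_{b\in H}P_b .$$ *)

(* Defs.v *)
From mathcomp Require Import all_boot all_order all_algebra.
From mathcomp Require Import reals.

Set Implicit Arguments.
Unset Strict Implicit.
Unset Printing Implicit Defensive.

Import Order.TTheory GRing.Theory Num.Theory.
Local Open Scope ring_scope.

(* finTBOrderType is the type of finite, nonempty, totally ordered types. *)
Record highwayProblem (R : realType) (N : finType) (d : Order.disp_t)
    (K : finTBOrderType d) := HighwayProblem {
  section_cost : K -> R;
  sections_of : N -> {set K};
  section_cost_ge0 : forall t, 0 <= section_cost t;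
  sections_of_neq0 : forall i, sections_of i != set0;
  sections_of_cover : \bigcup_(i : N) sections_of i = [set: K]
}.

Definition used_sections (R : realType) (N : finType) (d : Order.disp_t)
    (K : finTBOrderType d) (G : highwayProblem R N K) (S : {set N}) : {set K} :=
  \bigcup_(i in S) sections_of G i.

Definition total_cost (R : realType) (N : finType) (d : Order.disp_t)
    (K : finTBOrderType d) (G : highwayProblem R N K) (K' : {set K}) : R :=
  \sum_(t in K') section_cost G t.

Record costGame (R : realType) (N : finType) := CostGame {
  cost_of :> {set N} -> R;
  cost_of_set0 : cost_of set0 = 0
}.

Lemma total_cost_used_sections0 (R : realType) (N : finType) (d : Order.disp_t)
    (K : finTBOrderType d) (G : highwayProblem R N K) :
  total_cost G (used_sections G set0) = 0.
Proof. by rewrite /total_cost /used_sections !big_set0. Qed.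

Definition highway_game (R : realType) (N : finType) (d : Order.disp_t)
    (K : finTBOrderType d) (G : highwayProblem R N K) : costGame R N :=
  @CostGame R N (fun S => total_cost G (used_sections G S))
    (total_cost_used_sections0 G).

(* The A blocks of a partition of N, numbered without repetition; 'I_A plays
   the role of M = {1, ..., A}. MathComp's partition already requires the
   blocks to be nonempty. *)
Record coalitionStructure (N : finType) (A : nat) := CoalitionStructure {
  apriori_union :> 'I_A -> {set N};
  apriori_union_inj : injective apriori_union;
  apriori_union_partition :
    partition [set apriori_union a | a : 'I_A] [set: N]
}.

(* Meaningful for i \in P a; the index a is then determined by i. *)
Definition owen_value (R : realType) (N : finType) (A : nat)
    (c : costGame R N) (P : coalitionStructure N A) (a : 'I_A) (i : N) : R :=
  \sum_(H : {set 'I_A} | H \subset [set: 'I_A] :\ a)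
   \sum_(S : {set N} | S \subset P a :\ i)
    let U := \bigcup_(b in H) P b in
    1 / (#|P a|%:R * A%:R)
    * (1 / ('C(A - 1, #|H|)%:R * 'C(#|P a| - 1, #|S|)%:R))
    * (c (U :|: S :|: [set i]) - c (U :|: S)).

Definition unions_using (R : realType) (N : finType) (d : Order.disp_t)
    (K : finTBOrderType d) (A : nat) (G : highwayProblem R N K)
    (P : coalitionStructure N A) (t : K) : {set 'I_A} :=
  [set a | t \in used_sections G (P a)].

Definition members_using (R : realType) (N : finType) (d : Order.disp_t)
    (K : finTBOrderType d) (A : nat) (G : highwayProblem R N K)
    (P : coalitionStructure N A) (t : K) (a : 'I_A) : {set N} :=
  [set i in P a | t \in sections_of G i].

(* Main.v *)
(** For a section [t] of agent [i], the marginal contribution of [i] to a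
coalition [R :|: S] contains the cost of [t] iff [S] avoids the users of [t] in
the union of [i] and the unions in [R] avoid [t]. Hence the Owen sum splits,
section by section, into a product of two Shapley-type sums, each of which
gives the probability that a given element comes first among the users of [t],
that is, the inverse of their number. *)
Require Import Defs.
From mathcomp Require Import all_boot all_order all_algebra.
From mathcomp Require Import reals.
From mathcomp Require Import zify ring.

Set Implicit Arguments.
Unset Strict Implicit.
Unset Printing Implicit Defensive.

Import Order.TTheory GRing.Theory Num.Theory.
Local Open Scope ring_scope.

(** This is the Shapley coefficient: in a uniformly random order of [n] players, the probability
    that the predecessors of a fixed player are exactly a given set of [k] others. *)
Definition shapley_weight (F : numFieldType) (n k : nat) : F :=
  1 / (n%:R * 'C(n - 1, k)%:R).

(* This is Pascal's rule in Leibniz's harmonic triangle. *)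
Lemma shapley_weightD (F : numFieldType) (n k : nat) : (k <= n)%N ->
  shapley_weight F n.+2 k + shapley_weight F n.+2 k.+1 = shapley_weight F n.+1 k.
Proof.
move=> lekn; rewrite /shapley_weight !subn1 /=.
have C0 : 'C(n, k)%:R != 0 :> F by rewrite pnatr_eq0 -lt0n bin_gt0.
have C1 : 'C(n.+1, k)%:R != 0 :> F by rewrite pnatr_eq0 -lt0n bin_gt0 leqW.
have C2 : 'C(n.+1, k.+1)%:R != 0 :> F by rewrite pnatr_eq0 -lt0n bin_gt0 ltnS.
have n1 : n.+1%:R != 0 :> F by rewrite pnatr_eq0.
have n2 : n.+2%:R != 0 :> F by rewrite pnatr_eq0.
(* Over the common denominator [n.+1 * 'C(n, k)] the two numerators add up to [n.+2], which cancels
   the leading factor of the weights. *)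
have E1 : 'C(n.+1, k)%:R^-1 = (n.+1 - k)%:R / (n.+1%:R * 'C(n, k)%:R) :> F.
  apply: (mulfI C1); rewrite mulfV // mulrA -!natrM.
  by rewrite mulnC -mul_bin_down mulfV // natrM mulf_neq0.
have E2 : 'C(n.+1, k.+1)%:R^-1 = k.+1%:R / (n.+1%:R * 'C(n, k)%:R) :> F.
  apply: (mulfI C2); rewrite mulfV // mulrA -!natrM.
  by rewrite mulnC -mul_bin_diag mulfV // natrM mulf_neq0.
rewrite !mul1r !invfM E1 E2 -mulrDr -mulrDl -natrD.
have -> : (n.+1 - k + k.+1 = n.+2)%N by lia.
by rewrite invfM mulKf.
Qed.

(** Induction on [m]: Pascal's rule splits each binomial coefficient, and adjacent weights then
    merge by [shapley_weightD]. In terms of orders, a fixed player among [b.+1] users and [m]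
    non-users precedes all other users. *)
Lemma sum_bin_shapley_weight (F : numFieldType) (b m : nat) :
  \sum_(k < m.+1) 'C(m, k)%:R * shapley_weight F (b + m).+1 k = b.+1%:R^-1.
Proof.
elim: m => [|m IH].
  by rewrite big_ord1 bin0 addn0 /shapley_weight bin0 mul1r mulr1 div1r.
rewrite -IH big_ord_recl bin0 mul1r /=.
under eq_bigr => k _ do rewrite /bump /= add1n binS natrD mulrDl addnS.
(* The top term vanishes since ['C(m, m.+1)] is 0; the rest and the term at 0 form a full sum over
   [k < m.+1] again. *)
rewrite big_split /= big_ord_recr /= bin_small // mul0r addr0 addrA.
have -> : shapley_weight F (b + m.+1).+1 0
    + \sum_(k < m) 'C(m, k.+1)%:R * shapley_weight F (b + m).+2 k.+1
    = \sum_(k < m.+1) 'C(m, k)%:R * shapley_weight F (b + m).+2 k.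
  by rewrite big_ord_recl bin0 mul1r addnS.
rewrite -big_split /=; apply: eq_bigr => k _.
by rewrite -mulrDr shapley_weightD //; case: k => k /=; lia.
Qed.

Lemma sum_subsets_card (F : numFieldType) (T : finType) (Y : {set T})
    (g : nat -> F) :
  \sum_(S : {set T} | S \subset Y) g #|S| =
  \sum_(k < #|Y|.+1) 'C(#|Y|, k)%:R * g k.
Proof.
rewrite (partition_big (fun S : {set T} => inord #|S| : 'I_#|Y|.+1) xpredT) //=.
apply: eq_bigr => k _.
rewrite -cards_draws -[X in X%:R * _]sum1_card natr_sum mulr_suml.
apply: eq_big => [S|S /andP[SY /eqP <-]].
  rewrite inE; case: (boolP (S \subset Y)) => //= SY.
  by rewrite -val_eqE /= inordK // ltnS subset_leq_card.
by rewrite inordK ?ltnS ?subset_leq_card // mul1r.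
Qed.

(** As [x] lies in [B], the admissible [S] are just the subsets of [X :\: B]; counting them by size
    gives the previous sum with [b = #|B|.-1] and [m = #|X :\: B|]. *)
Lemma sum_shapley_weight_disjoint (F : numFieldType) (T : finType)
    (X B : {set T}) (x : T) : B \subset X -> x \in B ->
  \sum_(S : {set T} | (S \subset X :\ x) && [disjoint S & B])
    shapley_weight F #|X| #|S| = #|B|%:R^-1.
Proof.
move=> BX xB.
rewrite (eq_bigl (fun S : {set T} => S \subset X :\: B)); last first.
  move=> S; rewrite subsetD1 subsetD -andbA; congr (_ && _).
  by case: (boolP [disjoint S & B]) => [/disjointFl->//|_]; rewrite ?andbF.
rewrite sum_subsets_card.
have B0 : (0 < #|B|)%N by apply/card_gt0P; exists x.
have := cardsID B X; rewrite (setIidPr BX) => <-.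
by rewrite -[#|B| in LHS](prednK B0) addSn sum_bin_shapley_weight prednK.
Qed.

Section HighwayGame.
Variables (R : realType) (N : finType) (d : Order.disp_t).
Variables (K : finTBOrderType d) (G : highwayProblem R N K).

Lemma highway_game_marginal (S : {set N}) (i : N) :
  highway_game G (S :|: [set i]) - highway_game G S =
  \sum_(t in sections_of G i)
    section_cost G t * (t \notin used_sections G S)%:R.
Proof.
rewrite /= /total_cost /used_sections bigcup_setU big_set1.
rewrite (big_setID (\bigcup_(j in S) sections_of G j)) /= setUK.
rewrite [X in X - _]addrC addrK.
rewrite [RHS](bigID (fun t => t \in used_sections G S)) /=.
rewrite [X in _ = X + _]big1 => [|t /andP[_ ->]]; last by rewrite mulr0.
rewrite add0r; apply: eq_big => [t|t /[!inE] /andP[-> _]]; last by rewrite mulr1.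
by rewrite !inE andbC; case: (_ \in \bigcup_(_ in _) _); rewrite /= ?andbF ?andbT.
Qed.

Lemma notin_used_sectionsU (A : nat) (P : coalitionStructure N A) (a : 'I_A)
    (H : {set 'I_A}) (S : {set N}) (t : K) : S \subset P a ->
  (t \notin used_sections G ((\bigcup_(b in H) P b) :|: S)) =
  [disjoint H & unions_using G P t] && [disjoint S & members_using G P t a].
Proof.
move=> SP; apply/idP/andP => [tN|[HA SM]].
  split; apply/pred0P => x; apply/negP => /andP[/= xHS] /[!inE] xt;
    case/negP: tN; last first.
    by case/andP: xt => _ tx; apply/bigcupP; exists x; rewrite // inE xHS orbT.
  case/bigcupP: xt => j jx tj; apply/bigcupP; exists j => //.
  by rewrite inE; apply/orP; left; apply/bigcupP; exists x.
apply/bigcupP => -[j /setUP[/bigcupP[b bH jb]|jS] tj].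
  have /negP := disjointFr HA bH; apply.
  by rewrite inE; apply/bigcupP; exists j.
have /negP := disjointFr SM jS; apply.
by rewrite inE tj (subsetP SP).
Qed.

End HighwayGame.

Theorem proposition3p1 (R : realType) (N : finType) (d : Order.disp_t)
    (K : finTBOrderType d) (A : nat) (G : highwayProblem R N K)
    (P : coalitionStructure N A) (a : 'I_A) (i : N) (ia : i \in P a) :
  owen_value (highway_game G) P a i =
  \sum_(t in sections_of G i)
    section_cost G t / (#|unions_using G P t|%:R * #|members_using G P t a|%:R).
Proof.
rewrite /owen_value /=.
under eq_bigr => H _.
  under eq_bigr => S _.
    rewrite -/(highway_game G (_ :|: [set i])) -/(highway_game G (_ :|: S)).
    rewrite highway_game_marginal mulr_sumr.
    over.
  rewrite exchange_big /=.
  over.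
rewrite exchange_big /=; apply: eq_bigr => t ti.
have aU : a \in unions_using G P t.
  by rewrite inE; apply/bigcupP; exists i.
have iM : i \in members_using G P t a by rewrite inE ia.
have MP : members_using G P t a \subset P a.
  by apply/subsetP => j; rewrite inE => /andP[].
(* Each inverse is expanded back into a sum of weights: over sets [H] of unions for the first, over
   subsets [S] of [P a] for the second. *)
rewrite [in RHS]invfM -(sum_shapley_weight_disjoint R (subsetT _) aU).
rewrite -(sum_shapley_weight_disjoint R MP iM) cardsT card_ord.
rewrite mulr_suml mulr_sumr [RHS]big_mkcondr /=; apply: eq_bigr => H _.
rewrite mulr_sumr mulr_sumr big_mkcondr /=.
case: ifP => HU.
  apply: eq_bigr => S; rewrite subsetD1 => /andP[SP _].
  rewrite (notin_used_sectionsU _ _ _ SP) HU.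
  case: ifP => _; last by rewrite !mulr0.
  (* The Owen coefficient is the weight of [H] among the [A] unions times that of [S] within
     [P a]. *)
  by rewrite /shapley_weight !mul1r !invfM mulr1 /=; ring.
rewrite big1 // => S; rewrite subsetD1 => /andP[SP _].
by rewrite (notin_used_sectionsU _ _ _ SP) HU /= !mulr0.
Qed.
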